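(* Let $X$ be a real Banach space with the Daugavet property, let $T$ be a narrow operator on $X$ and let $T_1$ be a strong Radon-Nikodým operator on $X$. Then $T\mathbin{\tilde+}T_1$ is narrow; that is, writing $\mathcal{NAR}(X)$ for the class of narrow operators on $X$ and $\mathcal{SRN}(X)$ for the class of strong Radon-Nikodým operators on $X$, we have $\mathcal{NAR}(X)\mathbin{\tilde+}\mathcal{SRN}(X)=\mathcal{NAR}(X)$. In particular, every strong Radon-Nikodým operator on $X$ is a narrow operator.
   Context: All Banach spaces are real; $B(X)$ and $S(X)$ denote the closed unit ball and the unit sphere. An operator on $X$ is a bounded linear operator from $X$ into some Banach space (depending on the operator). $X$ has the Daugavet property if $\|\mathrm{Id}+R\|=1+\|R\|$ for every rank-one operator $R\colon X\to X$. Two operators $T_1,T_2$ on $X$ are identified (equivalent) if $\|T_1x\|=\|T_2x\|$ for all $x\in X$. For $T_1\colon X\to Y_1$, $T_2\colon X\to Y_2$, the operator $T_1\mathbin{\tilde+}T_2\colon X\to Y_1\oplus_1Y_2$ is $x\mapsto(T_1x,T_2x)$, so $\|(T_1\mathbin{\tilde+}T_2)x\|=\|T_1x\|+\|T_2x\|$. For classes of operators, $\mathcal M_1\mathbin{\tilde+}\mathcal M_2=\{T_1\mathbin{\tilde+}T_2: T_1\in\mathcal M_1,\ T_2\in\mathcal M_2\}$ (up to equivalence). $T$ is a strong Daugavet operator if for all $x,y\in S(X)$ and $\varepsilon>0$ there is $z\in S(X)$ with $\|T(z-y)\|<\varepsilon$ and $\|z+x\|>2-\varepsilon$. $T$ is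 narrow if $T\mathbin{\tilde+}x^*$ is a strong Daugavet operator for every $x^*\in X^*$. $T$ is a strong Radon-Nikodým operator if the closure of $T(B(X))$ is a set with the Radon-Nikodým property. A closed bounded convex set $C$ in a Banach space $Y$ has the Radon-Nikodým property if every nonempty subset $D\subset C$ is dentable, i.e. for every $\varepsilon>0$ there are $y^*\in Y^*$ and $\delta>0$ such that $\{d\in D: y^*(d)>\sup_D y^*-\delta\}$ has diameter less than $\varepsilon$. *)

(* Defs.v *)
From HB Require Import structures.
From mathcomp Require Import all_boot all_order all_algebra.
From mathcomp Require Import all_classical all_reals all_analysis.

Set Implicit Arguments.
Unset Strict Implicit.
Unset Printing Implicit Defensive.

Import Order.TTheory GRing.Theory Num.Theory.
Import numFieldNormedType.Exports.

Local Open Scope classical_set_scope.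
Local Open Scope ring_scope.

(* The l^1-sum of two normed spaces. The library norm on [Y1 * Y2] is the max
   norm, hence the alias. *)
Definition l1sum (Y1 Y2 : Type) : Type := (Y1 * Y2)%type.

Section L1sum.
Variables (R : realType) (Y1 Y2 : normedModType R).

HB.instance Definition _ := GRing.Lmodule.copy (l1sum Y1 Y2) (Y1 * Y2)%type.

Definition l1norm (y : l1sum Y1 Y2) : R := `|y.1| + `|y.2|.

Lemma ler_l1normD (x y : l1sum Y1 Y2) : l1norm (x + y) <= l1norm x + l1norm y.
Proof. by rewrite /l1norm addrACA lerD// ler_normD. Qed.

Lemma l1normZ (l : R) (x : l1sum Y1 Y2) : l1norm (l *: x) = `|l| * l1norm x.
Proof. by rewrite /l1norm !normrZ mulrDr. Qed.

Lemma l1norm0_eq0 (x : l1sum Y1 Y2) : l1norm x = 0 -> x = 0.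
Proof.
case: x => a b /eqP; rewrite /l1norm paddr_eq0 ?normr_ge0//= !normr_eq0.
by move=> /andP[/eqP -> /eqP ->].
Qed.

HB.instance Definition _ := Lmodule_isNormed.Build R (l1sum Y1 Y2)
  ler_l1normD l1normZ l1norm0_eq0.

Lemma l1sum_normE (y : l1sum Y1 Y2) : `|y| = `|y.1| + `|y.2|.
Proof. by []. Qed.

End L1sum.

Section L1sum_complete.
Variables (R : realType) (Y1 Y2 : completeNormedModType R).

Lemma l1sum_complete (F : set_system (l1sum Y1 Y2)) :
  ProperFilter F -> cauchy F -> cvg F.
Proof.
move=> FF /cauchyP Fc.
have c1 : cvg ((fst : l1sum Y1 Y2 -> Y1) @ F).
  apply: cauchy_cvg; apply/cauchyP => e e0; have [y Fy] := Fc e e0; exists y.1.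
  apply: (@filterS _ F _ (ball y e)) => // z; rewrite -!ball_normE/= l1sum_normE.
  by apply: le_lt_trans; rewrite lerDl.
have c2 : cvg ((snd : l1sum Y1 Y2 -> Y2) @ F).
  apply: cauchy_cvg; apply/cauchyP => e e0; have [y Fy] := Fc e e0; exists y.2.
  apply: (@filterS _ F _ (ball y e)) => // z; rewrite -!ball_normE/= l1sum_normE.
  by apply: le_lt_trans; rewrite lerDr.
move: c1 c2 => /cvg_ex[/= l1 /cvgrPdist_lt l1F] /cvg_ex[/= l2 /cvgrPdist_lt l2F].
apply/cvg_ex; exists ((l1, l2) : l1sum Y1 Y2); apply/cvgrPdist_lt => e e0.
near=> z; rewrite l1sum_normE/= (splitr e) ltrD//; near: z.
- by apply: l1F; rewrite divr_gt0.
- by apply: l2F; rewrite divr_gt0.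
Unshelve. all: by end_near. Qed.

HB.instance Definition _ :=
  Uniform_isComplete.Build (l1sum Y1 Y2) l1sum_complete.
End L1sum_complete.

Section Operators.
Variable R : realType.

(* Codomains vary with the operator, so they are bundled. *)
Record operator (X : normedModType R) := Operator {
  opcodom : completeNormedModType R;
  opfun :> {linear X -> opcodom};
  op_continuous : continuous opfun }.

Section OperatorSum.
Variables (X : normedModType R) (T1 T2 : operator X).

Definition opsum_fun (x : X) : l1sum (opcodom T1) (opcodom T2) := (T1 x, T2 x).

Lemma opsum_fun_linear : linear opsum_fun.
Proof. by move=> a x y; rewrite /opsum_fun !linearP. Qed.

HB.instance Definition _ := GRing.isLinear.Build R X
  (l1sum (opcodom T1) (opcodom T2)) *:%R opsum_fun opsum_fun_linear.

Lemma opsum_fun_continuous : continuous opsum_fun.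
Proof.
move=> x; apply/cvgrPdist_lt => e e0; near=> z.
rewrite l1sum_normE/= (splitr e) ltrD//; near: z.
- by move/cvgrPdist_lt: (@op_continuous X T1 x); apply; rewrite divr_gt0.
- by move/cvgrPdist_lt: (@op_continuous X T2 x); apply; rewrite divr_gt0.
Unshelve. all: by end_near. Qed.

Definition opsum : operator X :=
  @Operator X (l1sum (opcodom T1) (opcodom T2)) opsum_fun opsum_fun_continuous.

Definition op_equiv : Prop := forall x, `|T1 x| = `|T2 x|.

End OperatorSum.

(* A class of operators is a predicate rather than a [set]: [operator X] lies
   in a larger universe than the carriers allowed by [set]. *)
Definition op_class (X : normedModType R) := operator X -> Prop.

Definition class_sum (X : normedModType R) (M1 M2 : op_class X) : op_class X :=
  fun S => exists T1 T2, [/\ M1 T1, M2 T2 & op_equiv S (opsum T1 T2)].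

(* Meaningful for bounded [f]; otherwise the real [sup] is 0. *)
Definition opnorm (X Y : normedModType R) (f : X -> Y) : R :=
  sup [set `|f x| | x in [set x : X | `|x| <= 1]].

Definition rank_one (X Y : normedModType R) (f : {linear X -> Y}) : Prop :=
  exists2 y : Y, y != 0 & range f = range (fun a : R => a *: y).

Definition daugavet_property (X : normedModType R) : Prop :=
  forall A : {linear X -> X}, continuous A -> rank_one A ->
    opnorm (fun x : X => x + A x) = 1 + opnorm A.

Definition strong_daugavet (X : normedModType R) (T : operator X) : Prop :=
  forall (x y : X) (e : R), `|x| = 1 -> `|y| = 1 -> 0 < e ->
    exists z : X, [/\ `|z| = 1, `|T (z - y)| < e & `|z + x| > 2 - e].

Definition narrow (X : normedModType R) (T : operator X) : Prop :=
  forall (f : {linear X -> R^o}) (cf : continuous f),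
    strong_daugavet (opsum T (@Operator X R^o f cf)).

Definition diameter (Y : normedModType R) (A : set Y) : \bar R :=
  ereal_sup [set (`|p.1 - p.2|)%:E | p in A `*` A].

(* Used for bounded [D] only, so that the real [sup] is the supremum. *)
Definition slice (Y : normedModType R) (D : set Y) (f : Y -> R) (delta : R) :
    set Y :=
  [set d | D d /\ f d > sup (f @` D) - delta].

Definition dentable (Y : normedModType R) (D : set Y) : Prop :=
  forall e : R, 0 < e ->
    exists (f : {linear Y -> R^o}) (delta : R),
      [/\ continuous f, 0 < delta & (diameter (slice D f delta) < e%:E)%E].

Definition RNP_set (Y : normedModType R) (C : set Y) : Prop :=
  [/\ closed C, bounded_set C, convex_set (C : set (convex_lmodType Y))
    & forall D : set Y, D !=set0 -> D `<=` C -> dentable D].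

Definition strong_RN (X : normedModType R) (T : operator X) : Prop :=
  RNP_set (closure (T @` [set x : X | `|x| <= 1])).

Definition NAR (X : normedModType R) : op_class X := fun T => narrow T.

Definition SRN (X : normedModType R) : op_class X := fun T => strong_RN T.

End Operators.

Arguments NAR {R} X _.
Arguments SRN {R} X _.

(* Main.v *)
From HB Require Import structures.
Require Import Defs.
From mathcomp Require Import all_boot all_order all_algebra.
From mathcomp Require Import all_classical all_reals all_analysis.
From mathcomp Require Import ring lra.

(** Fix [y] in the unit ball and look at the tube [A] of those points [z] of
the ball with [T (z - y)] small.  Call a point [a] good, for an operator [T1]
and a tolerance [e], if every unit vector [x] admits [z] in [A] with
[T1 (z - a)] of norm less than [e] and [z + x] of norm almost 2.  To prove that
[opsum T T1] is a strong Daugavet operator it is enough to show that [y] is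
good for arbitrarily small tolerances.

Two facts do this.  The good points form a convex set ([daugavet_at_convex]):
given a convex combination of [a] and [b], one first chooses [z] near [a] for
the direction [x], then [z'] near [b] for the direction of [x + t z].  Hence, by
Hahn-Banach, if each half-space [phi (T1 a) > s] meeting [A] contains a good
point, then every point of [A] is good with any larger tolerance
([daugavet_at_dense]).

When [T1] is a strong Radon-Nikodym operator, a good point of such a half-space
comes from dentability: the image under [T1] of the part of [A] in the
half-space has a slice of diameter less than [e], cut out by some [h].  If
[T1 a] lies in this slice then [a] is good, because [T] summed with the two
functionals [phi \o T1] and [h \o T1] is a strong Daugavet operator: moving [a]
by an amount on which [T] and both functionals are tiny leaves the point in the
tube, in the half-space and in the slice.

Narrowness gives this for one functional at a time, so one needs that narrow
operators remain narrow after adding a functional.  This is the same argument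
with [T1 = (f, g)] into the plane, where small slices are available explicitly:
on the tube, a near-maximiser of [phi (T1 v) + c |T1 v|^2] lies in a slice, for
a single functional, on which [T1] has small oscillation
([slice_daugavet_functionals]).  This step uses of [T] only that slices of
tubes contain points almost aligned with any given unit vector, and for the
zero operator that is the Daugavet property applied to the operators
[v |-> h v *: x] ([daugavet_slice_zero]).  So the zero operator is narrow; adding
a strong Radon-Nikodym operator to it shows that the latter is narrow. *)

Set Implicit Arguments.
Unset Strict Implicit.
Unset Printing Implicit Defensive.

Import Order.TTheory GRing.Theory Num.Theory.
Import numFieldNormedType.Exports.

Local Open Scope classical_set_scope.
Local Open Scope ring_scope.

(** * Hahn-Banach separation *)

Definition sublinear (R : realType) (V : lmodType R) (q : V -> R) : Prop :=
  (forall x y, q (x + y) <= q x + q y) /\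
  (forall t x, 0 <= t -> q (t *: x) <= t * q x).

(** For [q] sublinear and [K] a convex cone below the graph of [q], this is the
largest sublinear function below [q] whose value at [- k.1] is at most [- k.2]
for all [k] in [K].  One such modification makes a minimal sublinear function
odd, and another one turns the norm into a function whose linear minorants
separate. *)
Definition cone_lower (R : realType) (V : lmodType R) (q : V -> R)
    (K : set (V * R)) (v : V) : R :=
  inf [set q (v + k.1) - k.2 | k in K].

Definition convex_cone (R : realType) (V : lmodType R) (K : set (V * R)) :
    Prop :=
  [/\ K (0, 0), forall k l, K k -> K l -> K (k.1 + l.1, k.2 + l.2)
    & forall t k, 0 <= t -> K k -> K (t *: k.1, t * k.2)].

Lemma sublinear0 (R : realType) (V : lmodType R) (q : V -> R) :
  sublinear q -> q 0 = 0.
Proof.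
move=> [qD qZ]; apply/eqP; rewrite eq_le; apply/andP; split.
  by have := qZ 0 0 (lexx _); rewrite scale0r mul0r.
by have := qD 0 0; rewrite addr0; lra.
Qed.

(** Subadditivity gives the lower bound [- q (- v)] on the values of which
[cone_lower q K v] is the infimum; a set of reals unbounded below has infimum 0 here. *)
Lemma cone_lower_le (R : realType) (V : lmodType R) (q : V -> R)
    (K : set (V * R)) (v w : V) (t : R) :
  sublinear q -> (forall k, K k -> k.2 <= q k.1) -> K (w, t) ->
  cone_lower q K v <= q (v + w) - t.
Proof.
move=> [qD _] Kq Kwt; apply: ge_inf; last by exists (w, t).
exists (- q (- v)) => _ [k /Kq kq <-].
have := qD (v + k.1) (- v); rewrite addrAC subrr add0r; lra.
Qed.

Lemma cone_lower_sublinear (R : realType) (V : lmodType R) (q : V -> R)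
    (K : set (V * R)) :
  sublinear q -> convex_cone K -> (forall k, K k -> k.2 <= q k.1) ->
  sublinear (cone_lower q K).
Proof.
move=> sq [K0 KD KZ] Kq; have [qD qZ] := sq.
have ne v : [set q (v + k.1) - k.2 | k in K] !=set0.
  by exists (q (v + 0) - 0), (0, 0).
split=> [x y|t x].
  rewrite -lerBlDr; apply: lb_le_inf (ne x) _ => _ [k Kk <-].
  rewrite lerBlDr -lerBlDl; apply: lb_le_inf (ne y) _ => _ [l Kl <-].
  have := cone_lower_le (x + y) sq Kq (KD _ _ Kk Kl).
  by have := qD (x + k.1) (y + l.1); rewrite addrACA; lra.
rewrite le_eqVlt => /predU1P[<-|t0].
  have := cone_lower_le (0 *: x) sq Kq K0.
  by rewrite scale0r addr0 (sublinear0 sq) mul0r subr0.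
rewrite -ler_pdivrMl//; apply: lb_le_inf (ne x) _ => _ [k Kk <-].
rewrite ler_pdivrMl// mulrBr.
have := cone_lower_le (t *: x) sq Kq (KZ _ _ (ltW t0) Kk).
by have := qZ t (x + k.1) (ltW t0); rewrite scalerDr; lra.
Qed.

(** Zorn's lemma: the pointwise infimum of a chain of sublinear functions is
sublinear, because for two members of the chain one lies below the other. *)
Lemma minimal_sublinear (R : realType) (V : lmodType R) (p : V -> R) :
  sublinear p -> exists q, [/\ sublinear q, forall x, q x <= p x &
    forall r, sublinear r -> (forall x, r x <= q x) -> forall x, q x <= r x].
Proof.
move=> sp; pose F := {q : V -> R | sublinear q /\ forall x, q x <= p x}.
pose p0 : F := exist _ p (conj sp (fun x => lexx (p x))).
pose below : rel F := fun s t => `[< forall x, sval t x <= sval s x >].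
have [||A Atot|[q [sq qp]] qmin] := @ZL_preorder F p0 below.
- by move=> t; apply/asboolP.
- move=> s r t /asboolP rs /asboolP st; apply/asboolP => x.
  exact: le_trans (st x) (rs x).
- have [[a Aa]|A0] := pselect (A !=set0); last first.
    by exists p0 => s As; case: A0; exists s.
  pose m x := inf [set sval s x | s in A].
  have ne x : [set sval s x | s in A] !=set0 by exists (sval a x), a.
  have mle s x : A s -> m x <= sval s x.
    move=> As; apply: ge_inf; last by exists s.
    exists (- p (- x)) => _ [r _ <-]; case: r => r [sr rp] /=.
    by have := sr.1 x (- x); rewrite subrr (sublinear0 sr);
      have := rp (- x); lra.
  have sm : sublinear m.
    split=> [x y|t x].
      rewrite -lerBlDr; apply: lb_le_inf (ne x) _ => _ [r Ar <-].
      rewrite lerBlDr -lerBlDl; apply: lb_le_inf (ne y) _ => _ [s As <-].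
      rewrite lerBlDl; have [/asboolP rs|/asboolP sr] := Atot _ _ Ar As.
        have := mle _ (x + y) As; have := (svalP s).1.1 x y.
        by have := rs x; lra.
      have := mle _ (x + y) Ar; have := (svalP r).1.1 x y.
      by have := sr y; lra.
    rewrite le_eqVlt => /predU1P[<-|t0].
      rewrite scale0r mul0r (le_trans (mle _ _ Aa))//.
      by rewrite (sublinear0 (svalP a).1).
    rewrite -ler_pdivrMl//; apply: lb_le_inf (ne x) _ => _ [r Ar <-].
    rewrite ler_pdivrMl// (le_trans (mle _ _ Ar))//.
    by apply: (svalP r).1.2; exact: ltW.
  have mp x : m x <= p x by rewrite (le_trans (mle _ _ Aa))// (svalP a).2.
  by exists (exist _ m (conj sm mp)) => s As; apply/asboolP => x; exact: mle.
exists q; split=> // r sr rq.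
have rp x : r x <= p x := le_trans (rq x) (qp x).
have := qmin (exist _ r (conj sr rp)).
by move=> /(_ (asboolT rq)) /asboolP.
Qed.

(** Hahn-Banach.  A minimal sublinear function [q] is linear: lowering it along
the ray spanned by [(y, q y)] cannot change it, and this forces
[q (- y) <= - q y]. *)
Lemma linear_below_sublinear (R : realType) (V : lmodType R) (p : V -> R) :
  sublinear p -> exists f : {linear V -> R^o}, forall x, f x <= p x.
Proof.
move=> /minimal_sublinear[q [sq qp qmin]]; have [qD qZ] := sq.
have q0 := sublinear0 sq.
have qN y : q (- y) = - q y.
  apply/eqP; rewrite eq_le; apply/andP; split; last first.
    by have := qD y (- y); rewrite subrr q0; lra.
  pose K : set (V * R) := [set (t *: y, t * q y) | t in [set t | 0 <= t]].
  have Kq k : K k -> k.2 <= q k.1.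
    move=> [t /= t0 <-] /=; have := t0.
    rewrite le_eqVlt => /predU1P[<-|tp]; first by rewrite mul0r scale0r q0.
    have := qZ t^-1 (t *: y); rewrite invr_ge0 => /(_ t0).
    by rewrite scalerK ?gt_eqF// -ler_pdivrMl ?invr_gt0// invrK.
  have cK : convex_cone K.
    split; first by exists 0; rewrite //= scale0r mul0r.
    - move=> _ _ [s /= s0 <-] [t /= t0 <-] /=.
      by exists (s + t); rewrite ?scalerDl ?mulrDl//= addr_ge0.
    - move=> s _ s0 [t /= t0 <-] /=.
      by exists (s * t); rewrite ?scalerA ?mulrA//= mulr_ge0.
  have lq := cone_lower_le _ sq Kq.
  have := qmin _ (cone_lower_sublinear sq cK Kq).
  have K0 : K (0, 0) by case: cK.
  have le_q x : cone_lower q K x <= q x.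
    by have := lq x _ _ K0; rewrite addr0 subr0.
  move=> /(_ le_q (- y)) /le_trans; apply.
  have Ky : K (y, q y) by exists 1; rewrite //= scale1r mul1r.
  by have := lq (- y) _ _ Ky; rewrite addNr q0 sub0r.
have qDE x y : q (x + y) = q x + q y.
  apply/eqP; rewrite eq_le qD/=.
  by have := qD (- x) (- y); rewrite -opprD !qN; lra.
have qZE t x : q (t *: x) = t * q x.
  wlog t0 : t / 0 <= t => [hw|].
    have [/hw//|t0] := leP 0 t.
    by have := hw (- t); rewrite oppr_ge0 (ltW t0) scaleNr qN mulNr;
      move=> /(_ isT) /oppr_inj.
  apply/eqP; rewrite eq_le qZ//=.
  by have := qZ t (- x) t0; rewrite scalerN !qN; lra.
have ql : linear (q : V -> R^o) by move=> t x y; rewrite qDE qZE.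
pose f : {linear V -> R^o} :=
  HB.pack (q : V -> R^o) (GRing.isLinear.Build R V R^o *:%R q ql).
by exists f.
Qed.

(** * Separation from a convex set *)

(** Convexity with a plain real weight, the form in which it is produced and
consumed below, instead of a weight in the type of the elements of the unit
interval. *)
Definition convex (R : realType) (V : lmodType R) (C : set V) : Prop :=
  forall a b t, C a -> C b -> 0 <= t <= 1 -> C (t *: a + (1 - t) *: b).

Lemma linear_norm_bound (R : realType) (V W : normedModType R)
    (f : {linear V -> W}) :
  continuous f -> exists2 M : R, 0 < M & forall x, `|f x| <= M * `|x|.
Proof. by move=> /linear_bounded_continuous/linear_boundedP/pinfty_ex_gt0. Qed.

Lemma norm_bound_continuous (R : realType) (V W : normedModType R)
    (f : {linear V -> W}) (M : R) :
  (forall x, `|f x| <= M * `|x|) -> continuous f.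
Proof.
move=> fM; apply/linear_bounded_continuous/linear_boundedP.
exists M; split; first exact: num_real.
by move=> r /ltW Mr x; rewrite (le_trans (fM x))// ler_wpM2r.
Qed.

(** Lower the norm along the cone generated by the vectors [p - c] with height
[rho]: the distance hypothesis says exactly that this cone lies below the norm,
and a linear minorant [f] then satisfies [f (p - c) >= rho] and
[f v <= `|v|]. *)
Lemma convex_separation (R : realType) (V : normedModType R) (C : set V)
    (p : V) (rho : R) :
  convex C -> 0 <= rho -> (forall c, C c -> rho <= `|p - c|) ->
  exists f : {linear V -> R^o},
    continuous f /\ forall c, C c -> f c + rho <= f p.
Proof.
move=> Ccvx rho0 Cfar.
pose K : set (V * R) := [set k | k = (0, 0) \/
  exists t c, [/\ 0 <= t, C c & k = (t *: (p - c), t * rho)]].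
have sn : sublinear (fun x : V => `|x|).
  by split=> [x y|t x t0]; rewrite ?ler_normD// normrZ ger0_norm.
have Kn k : K k -> k.2 <= `|k.1|.
  move=> [->|[t [c [t0 Cc ->]]]]; first by rewrite /= normr0.
  by rewrite /= normrZ ger0_norm// ler_wpM2l// Cfar.
have cK : convex_cone K.
  split; first by left.
  - move=> k l [->|Kk] [->|Kl] /=; rewrite ?addr0 ?add0r; first by left.
    + by right; case: Kl => t [c [t0 Cc ->]]; exists t, c.
    + by right; case: Kk => t [c [t0 Cc ->]]; exists t, c.
    right; move: Kk Kl => [s [a [s0 Ca ->]]] [t [b [t0 Cb ->]]] /=.
    have [st0|st0] := eqVneq (s + t) 0.
      have /andP[/eqP-> /eqP->] : (s == 0) && (t == 0).
        by rewrite -paddr_eq0// st0.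
      by exists 0, a; rewrite !scale0r !mul0r !addr0.
    have stp : 0 < s + t by rewrite lt_neqAle eq_sym st0 addr_ge0.
    exists (s + t), ((s / (s + t)) *: a + (1 - s / (s + t)) *: b).
    have -> : 1 - s / (s + t) = t / (s + t) by field.
    split; first exact: ltW.
      have := Ccvx a b (s / (s + t)) Ca Cb.
      have -> : 1 - s / (s + t) = t / (s + t) by field.
      apply; rewrite divr_ge0 ?(ltW stp)//= ler_pdivrMr// mul1r lerDl//.
    rewrite mulrDl; congr pair.
    rewrite [RHS]scalerBr [in RHS]scalerDr !scalerA !(mulrC (s + t)) !divfK//.
    by rewrite !scalerBr scalerDl opprD addrACA.
  - move=> t _ t0 [->|[s [c [s0 Cc ->]]]]; first by left; rewrite scaler0 mulr0.
    right; exists (t * s), c; rewrite /= scalerA mulrA; split=> //.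
    exact: mulr_ge0.
have [f fP] := linear_below_sublinear (cone_lower_sublinear sn cK Kn).
have lP := cone_lower_le _ sn Kn.
have f_le x : f x <= `|x|.
  have K0 : K (0, 0) by left.
  by have := lP x _ _ K0; rewrite addr0 subr0; exact: le_trans.
exists f; split.
  apply: (@norm_bound_continuous _ _ _ _ 1) => x; rewrite mul1r ler_norml f_le.
  by rewrite andbT lerNl -linearN/= -(normrN x) f_le.
move=> c Cc; rewrite addrC -lerBrDr -linearB/= -lerN2 -linearN/=.
have Kc : K (p - c, rho) by right; exists 1, c; rewrite scale1r mul1r.
rewrite (le_trans (fP _))// (le_trans (lP _ _ _ Kc))//.
by rewrite addNr normr0 sub0r.
Qed.

(** * Convexity and density of good points *)

(** The tolerance [e] on [T] is fixed while the defect [r] is arbitrary: the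
approximating point depends on [x] and [r], and the set of such [a] is convex
only because [r] may be shrunk between two successive choices. *)
Definition daugavet_at (R : realType) (X Y : normedModType R) (A : set X)
    (T : X -> Y) (e : R) (a : X) : Prop :=
  forall x (r : R), `|x| = 1 -> 0 < r ->
    exists z, [/\ A z, `|T (z - a)| < e & 2 - r < `|z + x|].

(** If [u] and [v] are almost aligned, then so are their nonnegative multiples:
from [a (u + v)] one only has to remove [(a - b) v], of norm at most [a - b]. *)
Lemma norm_combination_ge (R : realType) (X : normedModType R) (u v : X)
    (a b r : R) :
  `|u| <= 1 -> `|v| <= 1 -> 0 <= a -> 0 <= b -> 0 < r -> 2 - r < `|u + v| ->
  (1 - r) * (a + b) <= `|a *: u + b *: v|.
Proof.
wlog ba : u v a b / b <= a => [hw|].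
  have [ba|/ltW ab] := leP b a; first exact: hw.
  rewrite (addrC a) (addrC (a *: u)) (addrC u) => u1 v1 a0 b0 r0 uv.
  exact: hw.
move=> u1 v1 a0 b0 r0 uv.
have : a * (2 - r) <= `|a *: (u + v)|.
  by rewrite normrZ ger0_norm// ler_wpM2l// ltW.
have -> : a *: (u + v) = a *: u + b *: v + (a - b) *: v.
  by rewrite scalerDr -addrA -scalerDl (addrC b) subrK.
move=> /le_trans/(_ (ler_normD _ _)).
have : `|(a - b) *: v| <= a - b.
  by rewrite normrZ ger0_norm ?subr_ge0// ler_piMr ?subr_ge0.
have := mulr_ge0 b0 (ltW r0); lra.
Qed.

(** Choose [za] near [a] for the direction [x], then [zb] near [b] for the
direction [u] of [x + t za]; since both choices are almost aligned,
[x + t za + (1 - t) zb] has norm almost [1 + t + (1 - t)]. *)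
Lemma daugavet_at_convex (R : realType) (X Y : normedModType R) (A : set X)
    (T : {linear X -> Y}) (e : R) :
  convex A -> (forall z, A z -> `|z| <= 1) -> convex (daugavet_at A T e).
Proof.
move=> Acvx A1 a b t Da Db t01 x r x1 r0.
have /andP[t0 t1] := t01; have t1' : 0 <= 1 - t by rewrite subr_ge0.
(* Two successive defects [d] cost at most [4 d]. *)
have [d [d0 d1 dr]] : exists d : R, [/\ 0 < d, d < 1 & 4 * d <= r].
  exists (Num.min 2^-1 (r / 4)); split.
  - by rewrite lt_min invr_gt0 ltr0n divr_gt0.
  - by rewrite gt_min invf_lt1 ?ltr1n.
  - by rewrite mulrC -ler_pdivlMr// ge_min lexx orbT.
have [za [Aza Ta xa]] := Da x d x1 d0.
pose u := 1 *: x + t *: za.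
have u_ge : (1 - d) * (1 + t) <= `|u|.
  by apply: (norm_combination_ge _ (A1 _ Aza) ler01 t0 d0);
    rewrite ?x1// (addrC x).
have u0 : 0 < `|u|.
  by apply: lt_le_trans u_ge; rewrite mulr_gt0 ?subr_gt0// ltr_pwDl.
have v1 : `| `|u|^-1 *: u| = 1.
  by rewrite normrZ normfV normr_id mulVf ?gt_eqF.
have [zb [Azb Tb vb]] := Db _ d v1 d0.
exists (t *: za + (1 - t) *: zb); split; first exact: Acvx.
  have -> : t *: za + (1 - t) *: zb - (t *: a + (1 - t) *: b) =
            t *: (za - a) + (1 - t) *: (zb - b).
    by rewrite !scalerBr opprD addrACA.
  rewrite linearD !linearZ/= (le_lt_trans (ler_normD _ _))//.
  rewrite !normrZ !ger0_norm//.
  have Tb' : 0 < e - `|T (zb - b)| by rewrite subr_gt0.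
  have := t0; rewrite le_eqVlt => /predU1P[<-|tp].
    by rewrite mul0r add0r subr0 mul1r.
  have := mulr_ge0 t1' (ltW Tb'); have : 0 < t * (e - `|T (za - a)|).
    by rewrite mulr_gt0 ?subr_gt0.
  lra.
have : (1 - d) * (`|u| + (1 - t)) <= `| `|u| *: (`|u|^-1 *: u) + (1 - t) *: zb|.
  by apply: (norm_combination_ge _ (A1 _ Azb) _ t1' d0);
    rewrite ?v1// (addrC _ zb).
rewrite scalerA mulfV ?gt_eqF// scale1r.
have -> : u + (1 - t) *: zb = t *: za + (1 - t) *: zb + x.
  by rewrite /u scale1r [RHS]addrC addrA.
apply: lt_le_trans; have d1' : 0 <= 1 - d by rewrite subr_ge0 ltW.
have := ler_wpM2l d1' (lerD u_ge (lexx (1 - t))); apply: lt_le_trans.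
have := mulr_ge0 (ltW d0) t1'.
have : 0 < d * d * (1 + t) by rewrite !mulr_gt0// ltr_pwDl.
lra.
Qed.

(** If [T a] were at distance at least [eta] from the images of the good points,
which form a convex set, a functional would separate it from them and the
half-space containing [T a] would contain no good point. *)
Lemma daugavet_at_dense (R : realType) (X Y : normedModType R) (A : set X)
    (T : {linear X -> Y}) (e : R) :
  convex A -> (forall z, A z -> `|z| <= 1) ->
  (forall (phi : {linear Y -> R^o}) s, continuous phi ->
    (exists2 a, A a & s < phi (T a)) ->
    exists2 g, daugavet_at A T e g & s < phi (T g)) ->
  forall a eta, A a -> 0 < eta -> daugavet_at A T (e + eta) a.
Proof.
move=> Acvx A1 Aphi a eta Aa eta0; apply: contrapT => nDa.
pose C := T @` daugavet_at A T e.
have Ccvx : convex C.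
  move=> _ _ t [g Dg <-] [h Dh <-] t01; exists (t *: g + (1 - t) *: h).
    exact: daugavet_at_convex.
  by rewrite linearD !linearZ.
have [_ [g Dg <-]|phi [phic phiC]] :=
    convex_separation (p := T a) Ccvx (ltW eta0).
  rewrite leNgt; apply/negP => Tag; apply: nDa => x r x1 r0.
  have [z [Az Tz zx]] := Dg x r x1 r0; exists z; split=> //.
  rewrite -(subrKA g) linearD (le_lt_trans (ler_normD _ _))// ltrD//.
  by rewrite linearB/= distrC.
have [g Dg] : exists2 g, daugavet_at A T e g & phi (T a) - eta < phi (T g).
  by apply: Aphi => //; exists a; rewrite // ltrBlDr ltrDl.
by apply/negP; rewrite -leNgt lerBrDr; apply: phiC; exists g.
Qed.

(** From the sphere to the ball, a point [y] is a convex combination of a unit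
vector and its opposite, so convexity of the good points applies.  Conversely
the point [z] found in the ball has norm almost 1, as [z + x] has norm almost
2, and can be normalised. *)
Lemma strong_daugavetP (R : realType) (X : normedModType R) (T : operator X) :
  strong_daugavet T <->
  forall y e, `|y| <= 1 -> 0 < e ->
    daugavet_at [set z | `|z| <= 1] T e y.
Proof.
have Bcvx : convex [set z : X | `|z| <= 1].
  move=> a b t /= a1 b1 /andP[t0 t1]; rewrite (le_trans (ler_normD _ _))//.
  have t1' : 0 <= 1 - t by rewrite subr_ge0.
  rewrite !normrZ !ger0_norm//.
  by have := ler_wpM2l t0 a1; have := ler_wpM2l t1' b1; lra.
split=> [sd y e y1 e0 x r x1 r0|sd x y e x1 y1 e0].
  have sphere u : `|u| = 1 -> daugavet_at [set z | `|z| <= 1] T e u.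
    move=> u1 w s w1 s0; have es0 : 0 < Num.min e s by rewrite lt_min e0.
    have [z [z1 Tz zw]] := sd w u _ w1 u1 es0.
    exists z; split; first by rewrite /= z1.
      by rewrite (lt_le_trans Tz)// ge_min lexx.
    by rewrite (le_lt_trans _ zw)// lerD2l lerN2 ge_min lexx orbT.
  have [u u1 yu] : exists2 u, `|u| = 1 & y = `|y| *: u.
    have [->|yn0] := eqVneq y 0; first by exists x; rewrite // normr0 scale0r.
    exists (`|y|^-1 *: y).
      by rewrite normrZ normfV normr_id mulVf ?normr_eq0.
    by rewrite scalerA mulfV ?normr_eq0// scale1r.
  (* the weight for which [t u + (1 - t)(- u) = |y| u] *)
  pose t := (1 + `|y|) / 2.
  have t01 : 0 <= t <= 1 by rewrite /t; apply/andP; have := normr_ge0 y; lra.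
  suff : daugavet_at [set z | `|z| <= 1] T e (t *: u + (1 - t) *: (- u)).
    have -> : t *: u + (1 - t) *: (- u) = y.
      by rewrite scalerN -scalerBl [RHS]yu; congr (_ *: _); rewrite /t; field.
    exact.
  by apply: daugavet_at_convex => //; apply: sphere; rewrite ?normrN.
have [M M0 TM] := linear_norm_bound (@op_continuous _ _ T).
have [d [d0 d1 de Md]] : exists d,
    [/\ 0 < d, d < 1, 2 * d <= e & M * d <= e / 2].
  exists (Num.min 2^-1 (Num.min (e / 2) (e / 2 / M))); split.
  - by rewrite !lt_min invr_gt0 ltr0n !divr_gt0.
  - by rewrite gt_min invf_lt1 ?ltr1n.
  - by rewrite mulrC -ler_pdivlMr// !ge_min lexx orbT.
  - by rewrite mulrC -ler_pdivlMr// !ge_min lexx !orbT.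
have y1' : `|y| <= 1 by rewrite y1.
have e2 : 0 < e / 2 by rewrite divr_gt0.
have [z [/= z1 Tz zx]] := sd y (e / 2) y1' e2 x d x1 d0.
have z_gt : 1 - d < `|z| by have := ler_normD z x; rewrite x1; lra.
have z0 : 0 < `|z| by lra.
have zz : `| `|z|^-1 *: z - z| = 1 - `|z|.
  rewrite -{3}(scale1r z) -scalerBl normrZ ger0_norm ?subr_ge0 ?invf_ge1//.
  by rewrite mulrBl mulVf ?gt_eqF// mul1r.
exists (`|z|^-1 *: z); split.
- by rewrite normrZ normfV normr_id mulVf ?gt_eqF.
- rewrite -(subrKA z) linearD (le_lt_trans (ler_normD _ _))//.
  have := TM (`|z|^-1 *: z - z); rewrite zz.
  have : M * (1 - `|z|) <= M * d by rewrite ler_wpM2l ?(ltW M0)//; lra.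
  lra.
- have := ler_normD (z - `|z|^-1 *: z) (`|z|^-1 *: z + x).
  rewrite addrA subrK distrC zz; lra.
Qed.

(** * Slices of tubes *)

Definition tube (R : realType) (X : normedModType R) (T : operator X) (y : X)
    (e : R) : set X :=
  [set z | `|z| <= 1 /\ `|T (z - y)| < e].

Lemma tube_convex (R : realType) (X : normedModType R) (T : operator X) (y : X)
    (e : R) :
  convex (tube T y e).
Proof.
move=> a b t [a1 Ta] [b1 Tb] /andP[t0 t1].
have t1' : 0 <= 1 - t by rewrite subr_ge0.
split.
  rewrite (le_trans (ler_normD _ _))// !normrZ !ger0_norm//.
  by have := ler_wpM2l t0 a1; have := ler_wpM2l t1' b1; lra.
have -> : t *: a + (1 - t) *: b - y = t *: (a - y) + (1 - t) *: (b - y).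
  by rewrite !scalerBr addrACA -opprD -scalerDl addrCA subrr addr0 scale1r.
rewrite linearD !linearZ/= (le_lt_trans (ler_normD _ _))//.
rewrite !normrZ !ger0_norm//.
have Tb' : 0 < e - `|T (b - y)| by rewrite subr_gt0.
have := t0; rewrite le_eqVlt => /predU1P[<-|tp].
  by rewrite mul0r add0r subr0 mul1r.
have := mulr_ge0 t1' (ltW Tb'); have : 0 < t * (e - `|T (a - y)|).
  by rewrite mulr_gt0 ?subr_gt0.
lra.
Qed.

Lemma tube_near (R : realType) (X : normedModType R) (T : operator X)
    (y a z : X) (e : R) :
  `|z| <= 1 -> `|T (z - a)| < e - `|T (a - y)| -> tube T y e z.
Proof.
move=> z1 Tza; split=> //; rewrite -(subrKA a) linearD.
by rewrite (le_lt_trans (ler_normD _ _))// -ltrBrDr.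
Qed.

Lemma opsum_normE (R : realType) (X : normedModType R) (T1 T2 : operator X)
    (x : X) :
  `|opsum T1 T2 x| = `|T1 x| + `|T2 x|.
Proof. by []. Qed.

(** A common consequence of narrowness and, for the zero operator, of the
Daugavet property; it involves a single functional [h]. *)
Definition slice_daugavet (R : realType) (X : normedModType R)
    (T : operator X) : Prop :=
  forall y (e : R) (h : {linear X -> R^o}) (c : R) x (r : R),
    continuous h -> `|x| = 1 -> 0 < r ->
    (exists2 a, tube T y e a & c < h a) ->
    exists z, [/\ tube T y e z, c < h z & 2 - r < `|z + x|].

(** Take a point [a] of the slice and use that [T] summed with [h] is a strong
Daugavet operator, with a tolerance small enough to remain in the slice of the
tube. *)
Lemma narrow_slice (R : realType) (X : normedModType R) (T : operator X) :
  narrow T -> slice_daugavet T.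
Proof.
move=> nT y e h c x r hc x1 r0 [a [a1 Ta] ca].
have t0 : 0 < Num.min (e - `|T (a - y)|) (h a - c).
  by rewrite lt_min !subr_gt0 Ta.
have /strong_daugavetP sd := nT h hc.
have [z [z1 + zx]] := sd a _ a1 t0 x r x1 r0.
rewrite opsum_normE lt_min => /andP[zT zh]; exists z; split=> //.
  by apply: (tube_near (a := a)) => //; apply: le_lt_trans zT; rewrite lerDl.
have : `|h (z - a)| < h a - c by apply: le_lt_trans zh; rewrite lerDr.
by rewrite ltr_norml linearB/= => /andP[+ _]; lra.
Qed.

Lemma null_continuous (R : realType) (X : normedModType R) :
  continuous (\0 : {linear X -> R^o}).
Proof. by move=> x; exact: cvg_cst. Qed.

Definition zero_op (R : realType) (X : normedModType R) : operator X :=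
  @Operator R X R^o \0 (@null_continuous R X).

(** The Daugavet equation for [A v = h v *: x] gives [v] in the ball with
[v + h v *: x] of norm almost [1 + N], where [N] is the norm of [h].  Up to
replacing [v] by [- v], [h v] is then almost [N], so [v] is in the slice, and
[v] and [x] are almost aligned. *)
Lemma daugavet_slice_zero (R : realType) (X : normedModType R) :
  daugavet_property X -> slice_daugavet (zero_op X).
Proof.
move=> hX y e h c x r hc x1 r0 [a [a1 Ta] ca].
have e0 : 0 < e := le_lt_trans (normr_ge0 _) Ta.
have tubeE z : `|z| <= 1 -> tube (zero_op X) y e z by split; rewrite //= normr0.
have [h0|] := pselect (forall v, h v = 0).
  exists x; split; first by apply: tubeE; rewrite x1.
    by rewrite h0 -(h0 a).
  have -> : x + x = 2 *: x by rewrite scaler_nat mulr2n.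
  by rewrite normrZ x1 normr_nat; lra.
move=> /existsNP[w /eqP hw].
have Al : linear (fun v => (h v : R) *: x).
  by move=> t u v; rewrite linearP/= scalerDl scalerA.
pose A : {linear X -> X} := HB.pack (fun v => (h v : R) *: x)
  (GRing.isLinear.Build R X X *:%R _ Al).
have [M M0 hM] := linear_norm_bound hc.
have AE v : A v = (h v : R) *: x by [].
have normA v : `|A v| = `|h v| by rewrite AE normrZ x1 mulr1.
have cA : continuous A.
  by apply: (@norm_bound_continuous _ _ _ _ M) => v; rewrite normA.
have rA : rank_one A.
  exists x; first by rewrite -normr_eq0 x1 oner_eq0.
  apply/seteqP; split=> [_ [v _ <-]|_ [t _ <-]]; first by exists (h v).
  by exists ((t / h w) *: w) => //=; rewrite linearZ/=; congr (_ *: _);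
    exact: divfK.
have := hX A cA rA; set N := opnorm A => dauA.
have hN v : `|v| <= 1 -> `|h v| <= N.
  move=> v1; apply: ub_le_sup; last by exists v; rewrite // normA.
  by exists M => _ [u u1 <-]; rewrite normA (le_trans (hM u))//;
    rewrite ler_piMr// (ltW M0).
have N0 : 0 < N.
  have w0 : 0 < `|w|.
    by rewrite normr_gt0; apply: contra_neq hw => ->; rewrite linear0.
  apply: (lt_le_trans _ (hN (`|w|^-1 *: w) _)).
    by rewrite linearZ/= normr_gt0 scaler_eq0 negb_or invr_eq0 gt_eqF.
  by rewrite normrZ normfV normr_id mulVf ?gt_eqF.
have Nc : c < N by rewrite (lt_le_trans ca)// (le_trans (ler_norm _))// hN.
have [d [d0 dNc dN dNr dr]] : exists d,
    [/\ 0 < d, d <= N - c, d <= N / 2, d <= N * r / 4 & d <= r].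
  exists (Num.min (Num.min (N - c) (N / 2)) (Num.min (N * r / 4) r)).
  by rewrite !lt_min !ge_min !lexx !orbT subr_gt0 Nc r0 !divr_gt0// mulr_gt0.
have [v [v1 hv0 vA]] : exists v, [/\ `|v| <= 1, 0 <= h v &
     1 + N - d < `|v + (h v : R) *: x|].
  have [||_ [v /= v1 <-] vA] := @sup_gt R
      [set `|v + A v| | v in [set v : X | `|v| <= 1]] (1 + N - d).
  - by exists `|0 + A 0|, 0; rewrite //= normr0.
  - by rewrite -[sup _]/(opnorm (fun v => v + A v)) dauA ltrBlDr ltrDl.
  have [hv0|hv0] := leP 0 (h v); first by exists v.
  have hNv : h (- v) = - h v by rewrite linearN.
  exists (- v); split; first by rewrite normrN.
    by rewrite hNv oppr_ge0 ltW.
  by rewrite hNv scaleNr -opprD normrN.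
have hvN : h v <= N by rewrite (le_trans (ler_norm _))// hN.
have hv_gt : N - d < h v.
  have := ler_normD v ((h v : R) *: x).
  by rewrite normrZ x1 mulr1 ger0_norm//; lra.
exists v; split; [exact: tubeE|lra|].
(* Remove from [v + h v *: x] the excess of its longer term. *)
have [hv1|hv1] := leP 1 (h v).
  have := ler_normD (v + x) ((h v - 1 : R) *: x).
  rewrite normrZ x1 mulr1 ger0_norm ?subr_ge0// scalerBl scale1r.
  by rewrite addrACA subrr addr0; lra.
have := ler_normD ((h v : R) *: (v + x)) ((1 - h v : R) *: v).
rewrite !normrZ !ger0_norm ?subr_ge0 ?(ltW hv1)//.
have -> : (h v : R) *: (v + x) + (1 - h v : R) *: v = v + (h v : R) *: x.
  by rewrite scalerDr scalerBl scale1r addrC addrA subrK.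
have : (1 - h v) * `|v| <= 1 - h v by rewrite ler_piMr// subr_ge0 ltW.
have hv_pos : 0 < h v by lra.
move=> A1 A2; rewrite -(ltr_pM2l hv_pos).
have : (h v - N / 2) * r >= 0 by rewrite mulr_ge0 ?(ltW r0)// subr_ge0; lra.
lra.
Qed.

(** * Adding functionals to an operator *)

(** On the tube maximise [F = phi \o S + c (f^2 + g^2)] up to [eta], where [S]
is the pair [(f, g)].  At a near-maximiser [b] linearise [F] to [h], that
is [phi \o S] plus [2 c] times the inner product with [S b].  The identity
[c |S z - S b|^2 = F z - F b + (h b - h z)] shows that the slice of the tube
where [h z > h b - eta] has small image under [S].  For small [c] the point [b]
is still in the half-space where [phi \o S] exceeds [s]. *)
Lemma slice_daugavet_functionals (R : realType) (X : normedModType R)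
    (T : operator X) (f g : {linear X -> R^o}) (cf : continuous f)
    (cg : continuous g) :
  slice_daugavet T ->
  strong_daugavet (opsum (opsum T (@Operator R X R^o f cf))
                         (@Operator R X R^o g cg)).
Proof.
move=> sT; apply/strong_daugavetP => y e y1 e0 x r x1 r0.
pose S := opsum (@Operator R X R^o f cf) (@Operator R X R^o g cg).
have SE v : `|S v| = `|f v| + `|g v| by [].
pose e3 := e / 3; have e30 : 0 < e3 by rewrite divr_gt0.
have dS : daugavet_at (tube T y e3) S (e3 + e3) y; last first.
  have [z [[z1 Tz] Sz zx]] := dS x r x1 r0; exists z; split=> //.
  by move: Sz; rewrite SE !opsum_normE /e3 in Tz *; lra.
apply: daugavet_at_dense => //; [exact: tube_convex|by move=> z []| |];
  last first.
  by split; rewrite // subrr linear0 normr0.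
move=> phi s phic [a Aa sa].
have [Mf Mf0 fM] := linear_norm_bound cf.
have [Mg Mg0 gM] := linear_norm_bound cg.
have [Mp Mp0 pM] := linear_norm_bound phic.
have fb v : `|v| <= 1 -> `|f v| <= Mf.
  by move=> v1; rewrite (le_trans (fM v))// ler_piMr// ltW.
have gb v : `|v| <= 1 -> `|g v| <= Mg.
  by move=> v1; rewrite (le_trans (gM v))// ler_piMr// ltW.
pose k v := f v ^+ 2 + g v ^+ 2.
have k_ge0 v : 0 <= k v by rewrite addr_ge0 ?sqr_ge0.
pose B := Mf ^+ 2 + Mg ^+ 2.
have kB v : `|v| <= 1 -> k v <= B.
  move=> v1; rewrite lerD// -real_normK ?num_real// ler_sqr ?nnegrE ?fb ?gb//.
    exact: ltW.
  exact: ltW.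
have e3B : 0 < e3 ^+ 2 / 16 + B.
  by rewrite addr_gt0 ?addr_gt0 ?divr_gt0 ?exprn_gt0.
(* [c] makes [eta] plus the largest value of [c * k] on the ball equal to the
   room [phi (S a) - s] available for staying in the half-space. *)
pose c := (phi (S a) - s) / (e3 ^+ 2 / 16 + B).
have c0 : 0 < c by rewrite divr_gt0// subr_gt0.
have cE : c * (e3 ^+ 2 / 16 + B) = phi (S a) - s by rewrite divfK// gt_eqF.
pose eta := c * (e3 ^+ 2 / 16).
have eta0 : 0 < eta by apply: mulr_gt0 => //; rewrite divr_gt0 ?exprn_gt0.
pose F v := phi (S v) + c * k v.
have ubF : has_ubound (F @` tube T y e3).
  exists (Mp * (Mf + Mg) + c * B) => _ [v [v1 _] <-].
  rewrite lerD ?ler_wpM2l ?kB ?(ltW c0)//.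
  rewrite (le_trans (ler_norm _))// (le_trans (pM _))// ler_wpM2l ?(ltW Mp0)//.
  by rewrite SE lerD ?fb ?gb.
have [_ [b [b1 Tb] <-] Fb] : exists2 t, (F @` tube T y e3) t &
    sup (F @` tube T y e3) - eta < t.
  by apply: sup_adherent => //; split=> //; exists (F a), a.
pose hf v : R := phi (S v) + 2 * c * (f b * f v + g b * g v).
have hl : linear (hf : X -> R^o).
  move=> t u v; rewrite -[t *: hf u]/(t * hf u) /hf.
  have -> : phi (S (t *: u + v)) = t * phi (S u) + phi (S v).
    by rewrite !linearP.
  have -> : f (t *: u + v) = t * f u + f v by rewrite linearP.
  have -> : g (t *: u + v) = t * g u + g v by rewrite linearP.
  by ring.
pose h : {linear X -> R^o} :=
  HB.pack (hf : X -> R^o) (GRing.isLinear.Build R X R^o *:%R _ hl).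
have hE v : h v = phi (S v) + 2 * c * (f b * f v + g b * g v) by [].
have hc : continuous h.
  move=> v; apply: (@cvgD R R^o).
    exact: (continuous_comp (@op_continuous _ _ S v) (phic (S v))).
  apply: cvgM; first exact: cvg_cst.
  apply: (@cvgD R R^o); apply: cvgM; try exact: cvg_cst; [exact: cf|exact: cg].
exists b; last first.
  have : F a <= sup (F @` tube T y e3) by apply: ub_le_sup => //; exists a.
  have : c * k b <= c * B.
    by apply: ler_wpM2l; [exact: ltW|exact: kB].
  have := mulr_ge0 (ltW c0) (k_ge0 a); move: Fb cE.
  by rewrite /F /eta; lra.
move=> u t u1 t0; have [|z [[z1 Tz] hz zu]] :=
    sT y e3 h (h b - eta) u t hc u1 t0.
  by exists b; [split|rewrite ltrBlDr ltrDl].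
exists z; split=> //; rewrite SE !linearB/=.
have Fz : F z <= sup (F @` tube T y e3) by apply: ub_le_sup => //; exists z.
have sq : c * ((f z - f b) ^+ 2 + (g z - g b) ^+ 2) < c * (e3 ^+ 2 / 8).
  have -> : c * ((f z - f b) ^+ 2 + (g z - g b) ^+ 2) =
      F z - F b + (h b - h z) by rewrite !hE /F /k; ring.
  have : c * (e3 ^+ 2 / 8) = 2 * eta by rewrite /eta; field.
  lra.
move: sq; rewrite ltr_pM2l// => sq.
have half p : p ^+ 2 < e3 ^+ 2 / 4 -> `|p| < e3 / 2.
  move=> pe; rewrite -ltr_sqr ?nnegrE ?divr_ge0 ?(ltW e0)//.
  by rewrite real_normK ?num_real// (_ : (e3 / 2) ^+ 2 = e3 ^+ 2 / 4)//; field.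
rewrite (splitr e3) ltrD// half//.
  by have := sqr_ge0 (g z - g b); have := exprn_gt0 2 e30; lra.
by have := sqr_ge0 (f z - f b); have := exprn_gt0 2 e30; lra.
Qed.

Lemma narrow_opsum_functional (R : realType) (X : normedModType R)
    (T : operator X) (f : {linear X -> R^o}) (cf : continuous f) :
  narrow T -> narrow (opsum T (@Operator R X R^o f cf)).
Proof.
by move=> nT g cg; apply: slice_daugavet_functionals; exact: narrow_slice.
Qed.

(** * Adding a strong Radon-Nikodym operator *)

Lemma slice_dist_lt (R : realType) (Y : normedModType R) (D : set Y)
    (h : Y -> R) (delta e : R) (d d' : Y) :
  (diameter (slice D h delta) < e%:E)%E -> slice D h delta d ->
  slice D h delta d' -> `|d - d'| < e.
Proof.
move=> De Dd Dd'; rewrite -lte_fin (le_lt_trans _ De)//.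
by apply: ereal_sup_ubound; exists (d, d').
Qed.

(** Dentability of the image [D] of the part of the tube in a half-space gives
a slice of [D] of small diameter.  Any [b] mapped into that slice is good,
since [T] summed with the two functionals defining the half-space and the slice
is a strong Daugavet operator. *)
Lemma strong_daugavet_opsum_dentable (R : realType) (X : normedModType R)
    (T T1 : operator X) :
  narrow T ->
  (forall D, D !=set0 -> D `<=` T1 @` [set x | `|x| <= 1] -> dentable D) ->
  strong_daugavet (opsum T T1).
Proof.
move=> nT dent; apply/strong_daugavetP => y e y1 e0 x r x1 r0.
pose e3 := e / 3; have e30 : 0 < e3 by rewrite divr_gt0.
have dT1 : daugavet_at (tube T y e3) T1 (e3 + e3) y; last first.
  have [z [[z1 Tz] T1z zx]] := dT1 x r x1 r0; exists z; split=> //.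
  by rewrite opsum_normE; move: Tz T1z; rewrite /e3; lra.
apply: daugavet_at_dense => //; [exact: tube_convex|by move=> z []| |];
  last first.
  by split; rewrite // subrr linear0 normr0.
move=> phi s phic [a Aa sa].
pose D := T1 @` [set v | tube T y e3 v /\ s < phi (T1 v)].
have D0 : D !=set0 by exists (T1 a), a.
have DT1 : D `<=` T1 @` [set x | `|x| <= 1].
  by move=> _ [v [[v1 _] _] <-]; exists v.
have [h [delta [hc delta0 small]]] := dent D D0 DT1 e3 e30.
have [||_ [_ [b [[b1 Tb] sb] <-] <-] hb] :=
    @sup_gt R (h @` D) (sup (h @` D) - delta).
- by exists (h (T1 a)), (T1 a) => //; exists a.
- by rewrite ltrBlDr ltrDl.
have pc : continuous (phi \o T1).
  by move=> v; exact: (continuous_comp (@op_continuous _ _ T1 v) (phic _)).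
have hT1c : continuous (h \o T1).
  by move=> v; exact: (continuous_comp (@op_continuous _ _ T1 v) (hc _)).
exists b => // u t u1 t0.
have sd := narrow_opsum_functional pc nT hT1c.
pose tau := Num.min (e3 - `|T (b - y)|)
  (Num.min (phi (T1 b) - s) (h (T1 b) - (sup (h @` D) - delta))).
have tau0 : 0 < tau by rewrite !lt_min !subr_gt0 Tb sb.
have /strong_daugavetP/(_ b tau b1 tau0 u t u1 t0)[z [z1 + zu]] := sd.
rewrite !opsum_normE !lt_min /= => zb.
have pz : `|phi (T1 (z - b))| < phi (T1 b) - s.
  case/and3P: zb => _ + _; apply: le_lt_trans.
  by rewrite -addrA addrCA lerDl addr_ge0.
have hz : `|h (T1 (z - b))| < h (T1 b) - (sup (h @` D) - delta).
  by case/and3P: zb => _ _; apply: le_lt_trans; rewrite lerDr addr_ge0.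
have Az : tube T y e3 z.
  apply: (tube_near (a := b)) => //; case/and3P: zb => + _ _;
    apply: le_lt_trans.
  by rewrite -addrA lerDl addr_ge0.
exists z; split=> //; rewrite linearB/=.
apply: (slice_dist_lt small); split=> //.
- exists z => //; split=> //.
  by move: pz; rewrite !linearB/= ltr_norml => /andP[+ _]; lra.
- by move: hz; rewrite !linearB/= ltr_norml => /andP[+ _]; lra.
- by exists b.
Qed.

Lemma narrow_equiv (R : realType) (X : normedModType R) (T S : operator X) :
  op_equiv S T -> narrow T -> narrow S.
Proof.
move=> ST nT f cf x y e x1 y1 e0; have [z [z1 Tz zx]] := nT f cf x y e x1 y1 e0.
by exists z; split=> //; move: Tz; rewrite !opsum_normE ST.
Qed.

(** Attach the functional [f] of the definition of narrowness to [T] rather than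
to [T1], whose Radon-Nikodym property is thus used unchanged. *)
Lemma narrow_opsum_SRN (R : realType) (X : normedModType R)
    (T T1 : operator X) :
  narrow T -> strong_RN T1 -> narrow (opsum T T1).
Proof.
move=> nT [_ _ _ dent] f cf x y e x1 y1 e0.
have sd : strong_daugavet (opsum (opsum T (@Operator R X R^o f cf)) T1).
  apply: strong_daugavet_opsum_dentable => [|D D0 DT1].
    exact: narrow_opsum_functional.
  by apply: dent => //; apply: subset_trans DT1 _; exact: subset_closure.
have [z [z1 Tz zx]] := sd x y e x1 y1 e0.
by exists z; split=> //; move: Tz; rewrite !opsum_normE /= addrAC.
Qed.

Lemma zero_op_narrow (R : realType) (X : normedModType R) :
  daugavet_property X -> narrow (zero_op X).
Proof.
move=> hX f cf x y e x1 y1 e0.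
have := slice_daugavet_functionals (@null_continuous R X) cf
  (daugavet_slice_zero hX).
move=> /(_ x y e x1 y1 e0)[z [z1 Tz zx]].
by exists z; split=> //; move: Tz; rewrite !opsum_normE /= !normr0 !add0r.
Qed.

Lemma zero_op_SRN (R : realType) (X : normedModType R) : strong_RN (zero_op X).
Proof.
have cl0 : closed [set 0 : R^o].
  exact/accessible_closed_set1/hausdorff_accessible/norm_hausdorff.
rewrite /strong_RN.
have -> : closure (zero_op X @` [set x : X | `|x| <= 1]) = [set 0].
  have -> : zero_op X @` [set x : X | `|x| <= 1] = [set 0].
    apply/seteqP; split=> [_ [x _ <-]//|_ ->].
    by exists 0; rewrite //= normr0.
  by apply/esym/closure_id.
split.
- by [].
- by exists 0; split=> [|r r0 _ ->]; rewrite ?num_real //= normr0 ltW.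
- by move=> x y t; rewrite !inE => -> ->; rewrite convmm.
move=> D _ D0 e e0; exists \0, 1; split => //; first exact: null_continuous.
apply: (@le_lt_trans _ _ 0%E); last by rewrite lte_fin.
apply: ge_ereal_sup => _ [[a b] [[/D0 -> _] [/D0 -> _]] <-] /=.
by rewrite subrr normr0.
Qed.

Theorem theorem3p13 (R : realType) (X : completeNormedModType R)
    (hX : daugavet_property X) :
  (forall T T1 : operator X, narrow T -> strong_RN T1 -> narrow (opsum T T1)) /\
  class_sum (NAR X) (SRN X) = NAR X /\
  (forall T1 : operator X, strong_RN T1 -> narrow T1).
Proof.
have nz := zero_op_narrow hX.
split; first by move=> T T1; exact: narrow_opsum_SRN.
split; last first.
  move=> T1 sT1; apply: narrow_equiv (narrow_opsum_SRN nz sT1) => x.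
  by rewrite opsum_normE /= normr0 add0r.
apply/funext => S; apply/propext; split=> [[T [T1 [nT sT1 ST]]]|nS].
  exact: narrow_equiv ST (narrow_opsum_SRN nT sT1).
exists S, (zero_op X); split=> //; first exact: zero_op_SRN.
by move=> x; rewrite opsum_normE /= normr0 addr0.
Qed.
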